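(* Let $0<p\le 1$ and let $(\mathcal M,\rho)$ be a pointed $p$-metric space. Then $(\mathcal P(\mathcal M),\|\cdot\|_{\mathcal F_p(\mathcal M)})$ is a $p$-normed space.
   Context: All vector spaces are real. For $0<p\le 1$, a $p$-metric on a set $\mathcal{M}$ is a symmetric map $\rho\colon\mathcal M\times\mathcal M\to[0,\infty)$ with $\rho(x,y)=0$ iff $x=y$ and $\rho(x,y)^p\le\rho(x,z)^p+\rho(z,y)^p$ for all $x,y,z$. A pointed space has a distinguished point $0$. A $p$-norm on a vector space $Y$ is a map $\|\cdot\|_Y\colon Y\to[0,\infty)$ with $\|y\|_Y>0$ for $y\ne0$, $\|\alpha y\|_Y=|\alpha|\|y\|_Y$ and $\|y+z\|_Y^p\le\|y\|_Y^p+\|z\|_Y^p$; a $p$-normed space is a vector space with a $p$-norm. A map $f\colon\mathcal M\to Y$ is $1$-Lipschitz if $\|f(x)-f(y)\|_Y\le\rho(x,y)$ for all $x,y$. Let $\mathbb R_0^{\mathcal M}$ be the space of all functions $f\colon\mathcal M\to\mathbb R$ with $f(0)=0$, let $\delta(x)$ be the linear functional on $\mathbb R_0^{\mathcal M}$ given by $\langle\delta(x),f\rangle=f(x)$, and let $\mathcal P(\mathcal M)$ be the linear span of $\{\delta(x)\colon x\in\mathcal M\}$ in the algebraic dual of $\mathbb R_0^{\mathcal M}$. For $\mu=\sum_{j=1}^N a_j\delta(x_j)\in\mathcal P(\mathcal M)$ put $$\|\mu\|_{\mathcal F_p(\mathcal M)}=\sup\Big\|\sum_{j=1}^N a_jf(x_j)\Big\|_Y,$$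 the supremum being over all $p$-normed spaces $(Y,\|\cdot\|_Y)$ and all $1$-Lipschitz maps $f\colon\mathcal M\to Y$ with $f(0)=0$. *)

(* Defs.v *)
From HB Require Import structures.
From mathcomp Require Import all_boot all_order all_algebra.
From mathcomp Require Import all_classical all_reals ereal exp.

Set Implicit Arguments.
Unset Strict Implicit.
Unset Printing Implicit Defensive.

Import Order.TTheory GRing.Theory Num.Theory.
Local Open Scope classical_set_scope.
Local Open Scope ring_scope.

Record is_pmetric (R : realType) (p : R) (M : Type) (rho : M -> M -> R) :
    Prop := IsPMetric {
  pmetric_ge0 : forall x y, 0 <= rho x y ;
  pmetric_sym : forall x y, rho x y = rho y x ;
  pmetric_eq0 : forall x y, rho x y = 0 <-> x = y ;
  pmetric_triangle : forall x y z,
    rho x y `^ p <= rho x z `^ p + rho z y `^ p }.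

Record is_pnorm (R : realType) (p : R) (Y : lmodType R) (nY : Y -> R) :
    Prop := IsPNorm {
  pnorm_ge0 : forall y, 0 <= nY y ;
  pnorm_gt0 : forall y, y != 0 -> 0 < nY y ;
  pnormZ : forall a y, nY (a *: y) = `|a| * nY y ;
  pnorm_triangle : forall y z, nY (y + z) `^ p <= nY y `^ p + nY z `^ p }.

Section AlgebraicDual.
Variables (R : realType) (V : lmodType R).

Definition linear_pred : {pred V -> R^o} := fun phi => `[< linear phi >].

Fact linear_pred_submod_closed : submod_closed linear_pred.
Proof.
split; first by apply/asboolP => a u v /=; rewrite scaler0 addr0.
move=> c f g /asboolP fL /asboolP gL; apply/asboolP => a u v /=.
rewrite !fctE fL gL !scalerDr !scalerA (mulrC c a) -!addrA; congr (_ + _).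
by rewrite addrCA.
Qed.
HB.instance Definition _ :=
  GRing.isSubmodClosed.Build R (V -> R^o) linear_pred linear_pred_submod_closed.

Record dual := Dual { dual_fun :> V -> R^o ; _ : dual_fun \in linear_pred }.
HB.instance Definition _ := [isSub for dual_fun].
HB.instance Definition _ := [Choice of dual by <:].
HB.instance Definition _ := [SubChoice_isSubLmodule of dual by <:].

Fact dual_fun_is_linear (phi : dual) : linear phi.
Proof. by case: phi => phi /= /asboolP. Qed.
HB.instance Definition _ (phi : dual) :=
  GRing.isLinear.Build R V R^o *:%R (dual_fun phi) (dual_fun_is_linear phi).

End AlgebraicDual.

Section LinearSpan.
Variables (R : realType) (V : lmodType R) (A : set V).

Definition span_pred : {pred V} := fun v =>
  `[< exists (N : nat) (a : 'I_N -> R) (w : 'I_N -> V),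
        (forall j, A (w j)) /\ v = \sum_(j < N) a j *: w j >].

Fact span_pred_submod_closed : submod_closed span_pred.
Proof.
split.
  by apply/asboolP; exists 0%N, (fun=> 0), (fun=> 0); split=> [[]//|]; rewrite big_ord0.
move=> c _ _ /asboolP[m [a [u [uA ->]]]] /asboolP[n [b [v [vA ->]]]].
apply/asboolP; exists (m + n)%N,
  (fun k : 'I_(m + n) => match fintype.split k with inl i => c * a i | inr j => b j end),
  (fun k : 'I_(m + n) => match fintype.split k with inl i => u i | inr j => v j end).
split=> [k|]; first by case: (fintype.split k).
rewrite big_split_ord /= scaler_sumr; congr (_ + _); apply: eq_bigr => i _.
  by rewrite scalerA; case: split_ordP => [j /lshift_inj <-//|j /eqP]; rewrite eq_lrshift.
by case: split_ordP => [j /eqP|j /rshift_inj <-//]; rewrite eq_rlshift.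
Qed.
HB.instance Definition _ :=
  GRing.isSubmodClosed.Build R V span_pred span_pred_submod_closed.

Record span := Span { span_val :> V ; _ : span_val \in span_pred }.
HB.instance Definition _ := [isSub for span_val].
HB.instance Definition _ := [Choice of span by <:].
HB.instance Definition _ := [SubChoice_isSubLmodule of span by <:].

Fact mem_span v : A v -> v \in span_pred.
Proof.
move=> vA; apply/asboolP; exists 1%N, (fun=> 1), (fun=> v); split=> //.
by rewrite big_ord1 scale1r.
Qed.

End LinearSpan.

(* The distinguished point 0 of a pointed space is [point : M]. *)
Section FreeSpace.
Variables (R : realType) (M : pointedType).

(* [fct0] is R_0^M, [molecules] is P(M). *)
Definition vanish_pred : {pred M -> R^o} := fun f => f point == 0.

Fact vanish_pred_submod_closed : submod_closed vanish_pred.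
Proof.
split; first exact/eqP.
by move=> a f g /eqP f0 /eqP g0; apply/eqP; rewrite !fctE f0 g0 scaler0 addr0.
Qed.
HB.instance Definition _ :=
  GRing.isSubmodClosed.Build R (M -> R^o) vanish_pred vanish_pred_submod_closed.

Record fct0 := Fct0 { fct0_fun :> M -> R^o ; _ : fct0_fun \in vanish_pred }.
HB.instance Definition _ := [isSub for fct0_fun].
HB.instance Definition _ := [Choice of fct0 by <:].
HB.instance Definition _ := [SubChoice_isSubLmodule of fct0 by <:].

Fact evaluation_linear (x : M) : (fun f : fct0 => f x) \in @linear_pred R fct0.
Proof. by apply/asboolP. Qed.

Definition evaluation (x : M) : dual fct0 := Dual (evaluation_linear x).

Definition molecules := span (range evaluation).
HB.instance Definition _ := GRing.Lmodule.on molecules.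

Definition delta (x : M) : molecules := Span (mem_span (imageT evaluation x)).

Variables (p : R) (rho : M -> M -> R).

Local Open Scope ereal_scope.

(* The supremum attached to the expression sum_j a_j delta(x_j). *)
Definition Fp_sup (N : nat) (a : 'I_N -> R) (x : 'I_N -> M) : \bar R :=
  ereal_sup [set r : \bar R |
    exists (Y : lmodType R) (nY : Y -> R) (f : M -> Y),
      [/\ is_pnorm p nY,
          forall u v, (nY (f u - f v) <= rho u v)%R,
          f point = 0%R
        & r = (nY (\sum_(j < N) a j *: f (x j))%R)%:E]].

(* The value of Fp_sup at some expression of mu as a linear combination of    *)
(* the delta(x_j); that it does not depend on the expression is not built in, *)
(* and has to be proved.                                                      *)
Definition Fp_norm (mu : molecules) : \bar R :=
  xget 0 [set r : \bar R |
    exists (N : nat) (a : 'I_N -> R) (x : 'I_N -> M),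
      mu = (\sum_(j < N) a j *: delta (x j))%R /\ r = Fp_sup a x].

End FreeSpace.

(* Main.v *)
Require Import Defs.
From mathcomp Require Import all_boot all_order all_algebra.
From mathcomp Require Import all_classical all_reals ereal exp.
From mathcomp Require Import measure measurable_realfun.
From mathcomp Require Import lebesgue_measure numfun lebesgue_integral.

(** The idea is to identify the supremum defining the norm of a molecule with the
    value of a single functional: N(mu), the supremum of q(mu) over all
    p-seminorms q on the space of molecules with
    q(delta(x) - delta(y)) <= rho(x, y).

    A 1-Lipschitz map f from M to a p-normed space Y with f(0) = 0 extends to a
    linear map L on molecules ([linear_extension]), whatever expression of the
    molecule is used, because a molecule determines the weights of its atoms
    away from the base point. The functional q = ||L(.)|| is one of the
    competitors in N, so every test value is at most N(mu). Conversely, the map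
    delta into the molecules normed by N is itself a test map, provided that N is
    a p-norm. Hence the supremum is N(mu) ([Fp_supE]), and everything reduces to
    N being a p-norm.

    A supremum of p-seminorms is a p-seminorm as soon as it is finite
    ([pnorm_sup]), and finiteness follows from q(delta(x)) <= rho(x, 0). The
    point is positivity: each nonzero molecule mu needs a competitor q with
    q(mu) > 0. Since d = rho ^ p is a metric, put, for a center c,
      q_c(mu) = (\int |mu(B(c, s))| ^ p ds) ^ (1 / p)
    with B(c, s) the d-ball of radius s. Here mu(B) stands for the value of mu on
    the function 1_B - 1_B(0): the mass of B when B does not contain the base
    point, and minus the mass of its complement otherwise. The functional q_c is
    a p-seminorm since t |-> t ^ p is subadditive. For mu = delta(x) - delta(y),
    the integrand is the indicator of an interval of length
    |d(c, x) - d(c, y)| <= d(x, y) ([ball_int_delta]). If c is an atom of mu other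
    than the base point, then all small balls around c have the same nonzero
    mass, and q_c(mu) > 0 ([ball_int_gt0]). *)

Set Implicit Arguments.
Unset Strict Implicit.
Unset Printing Implicit Defensive.

Import Order.TTheory GRing.Theory Num.Theory.
Local Open Scope ring_scope.

(** * Powers with exponent at most 1 *)

Section Powers.
Context {R : realType}.
Implicit Types p x y : R.

Lemma powRK p x : p != 0 -> 0 <= x -> (x `^ p) `^ p^-1 = x.
Proof. by move=> p0 x0; rewrite -powRrM mulfV// powRr1. Qed.

Lemma powRVK p x : p != 0 -> 0 <= x -> (x `^ p^-1) `^ p = x.
Proof. by move=> p0 x0; rewrite -powRrM mulVf// powRr1. Qed.

(** A number of [0, 1] lies below its p-th power; this is applied to the shares
    x / (x + y) and y / (x + y), which add up to 1. *)
Lemma powR_subadditive p x y : 0 < p <= 1 -> 0 <= x -> 0 <= y ->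
  (x + y) `^ p <= x `^ p + y `^ p.
Proof.
move=> /andP[p0 p1] x0 y0.
have [s0|s_neq0] := eqVneq (x + y) 0.
  by rewrite s0 powR0 ?gt_eqF// addr_ge0// powR_ge0.
have s0 : 0 < x + y by rewrite lt_neqAle eq_sym s_neq0 addr_ge0.
have key t : 0 <= t -> t <= x + y -> t / (x + y) * (x + y) `^ p <= t `^ p.
  move=> t0 ts; rewrite -[in leRHS](divfK s_neq0 t).
  have ts0 : 0 <= t / (x + y) by rewrite divr_ge0// ltW.
  rewrite powRM ?(ltW s0)// ler_wpM2r ?powR_ge0//.
  have [->|t_neq0] := eqVneq t 0; first by rewrite mul0r powR_ge0.
  have tpos : 0 < t by rewrite lt_neqAle eq_sym t_neq0.
  rewrite -[leLHS]powRr1//.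
  by rewrite ger_powR// ?divr_gt0// ?ler_pdivrMr// mul1r.
have -> : (x + y) `^ p =
    x / (x + y) * (x + y) `^ p + y / (x + y) * (x + y) `^ p.
  by rewrite -mulrDl -mulrDl divff// mul1r.
by rewrite lerD// key// ?lerDl// lerDr.
Qed.

Lemma powR_normD p x y : 0 < p <= 1 ->
  `|x + y| `^ p <= `|x| `^ p + `|y| `^ p.
Proof.
move=> p01; apply: le_trans (powR_subadditive p01 (normr_ge0 x) (normr_ge0 y)).
have /andP[/ltW p0 _] := p01.
by apply: ge0_ler_powR; rewrite // ?nnegrE ?addr_ge0 ?ler_normD.
Qed.

End Powers.

(** * Suprema of p-seminorms *)

Definition is_pseminorm (R : realType) (p : R) (Y : lmodType R) (q : Y -> R) :=
  [/\ forall y, 0 <= q y,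
      forall a y, q (a *: y) = `|a| * q y
    & forall y z, q (y + z) `^ p <= q y `^ p + q z `^ p].

(** Homogeneity and the p-triangle inequality pass to suprema; the separation
    hypothesis supplies positivity. *)
Lemma pnorm_sup (R : realType) (p : R) (Y : lmodType R) (S : set (Y -> R)) :
    0 < p ->
    (S !=set0)%classic ->
    (forall q, S q -> is_pseminorm p q) ->
    (forall y, has_ubound [set q y | q in S]%classic) ->
    (forall y, y != 0 -> exists2 q, S q & 0 < q y) ->
  is_pnorm p (fun y => sup [set q y | q in S]%classic).
Proof.
move=> p0 [q0 Sq0] Ssemi Sbnd Ssep.
have pneq0 : p != 0 by rewrite gt_eqF.
set N := fun y => sup _.
have leN q y : S q -> q y <= N y by move=> Sq; apply: ub_le_sup => //; exists q.
have Nle y C : (forall q, S q -> q y <= C) -> N y <= C.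
  move=> H; apply: ge_sup; first by exists (q0 y), q0.
  by move=> _ [q Sq <-]; exact: H.
have N0 y : 0 <= N y by apply: le_trans (leN _ y Sq0); case: (Ssemi _ Sq0).
have NZle a y : N (a *: y) <= `|a| * N y.
  apply: Nle => q Sq; have [_ -> _] := Ssemi _ Sq.
  by rewrite ler_wpM2l// leN.
split=> //.
- by move=> y /Ssep[q Sq qy]; apply: lt_le_trans qy (leN _ _ Sq).
(* The reverse inequality is NZle at the vector a *: y with the scalar a^-1. *)
- move=> a y; apply/eqP; rewrite eq_le NZle/=.
  have [->|a0] := eqVneq a 0; first by rewrite normr0 mul0r.
  rewrite -ler_pdivlMl ?normr_gt0// -normfV.
  by apply: le_trans (NZle _ _); rewrite scalerA mulVf// scale1r.
- move=> y z; set C := leRHS.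
  have C0 : 0 <= C by rewrite addr_ge0// powR_ge0.
  rewrite -(powRVK pneq0 C0).
  apply: ge0_ler_powR; rewrite ?nnegrE ?powR_ge0 ?(ltW p0)//.
  apply: Nle => q Sq; have [q_ge0 _ qD] := Ssemi _ Sq.
  rewrite -[leLHS](powRK pneq0)//.
  apply: ge0_ler_powR; rewrite ?nnegrE ?powR_ge0 ?invr_ge0 ?(ltW p0)//.
  by apply: le_trans (qD y z) _; apply: lerD; apply: ge0_ler_powR;
    rewrite ?nnegrE ?(ltW p0)// leN.
Qed.

(** * Molecules and linear extension *)

Section DualAndSpan.
Variables (R : realType) (V : lmodType R).

Lemma dual_funD (phi psi : Defs.dual V) v : (phi + psi) v = phi v + psi v.
Proof. by []. Qed.

Lemma dual_funZ a (phi : Defs.dual V) v : (a *: phi) v = a * phi v.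
Proof. by []. Qed.

Lemma span_valD (A : set V) (u v : Defs.span A) :
  span_val (u + v) = span_val u + span_val v.
Proof. by []. Qed.

Lemma span_valZ (A : set V) a (u : Defs.span A) :
  span_val (a *: u) = a *: span_val u.
Proof. by []. Qed.

End DualAndSpan.

Section Molecules.
Variables (R : realType) (M : pointedType).

(** Formal combinations are lists, possibly with repeated points, because
    sums of molecules then correspond to concatenations. *)
Definition lincomb (Y : lmodType R) (f : M -> Y) (s : seq (R * M)) : Y :=
  \sum_(u <- s) u.1 *: f u.2.

Lemma lincomb_ord (Y : lmodType R) (f : M -> Y) (N : nat) (a : 'I_N -> R)
    (x : 'I_N -> M) :
  \sum_(j < N) a j *: f (x j) = lincomb f [seq (a j, x j) | j <- enum 'I_N].
Proof. by rewrite /lincomb big_map big_enum. Qed.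

Lemma lincomb_scaleD (Y : lmodType R) (f : M -> Y) c s t :
  c *: lincomb f s + lincomb f t =
  lincomb f ([seq (c * u.1, u.2) | u <- s] ++ t).
Proof.
rewrite /lincomb big_cat big_map scaler_sumr; congr (_ + _).
by apply: eq_bigr => u _; rewrite scalerA.
Qed.

Lemma molecule_lincomb (mu : molecules R M) :
  exists s, mu = lincomb (@delta R M) s.
Proof.
case: mu => v vP; move/asboolP: (vP) => [N [a [w [wA vE]]]].
have /choice[x xE] j : exists z, evaluation R z = w j.
  by case: (wA j) => z _ <-; exists z.
exists [seq (a j, x j) | j <- enum 'I_N]; apply: val_inj; rewrite /= vE.
rewrite -lincomb_ord (big_morph (@span_val _ _ _) (id1 := 0) (op1 := +%R))//.
by apply: eq_bigr => j _; rewrite -xE.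
Qed.

(** Group the terms of the sum by their point: the weight of a point other than
    the base point vanishes, and f vanishes at the base point. *)
Lemma lincomb_eq0 (Y : lmodType R) (f : M -> Y) s : f point = 0 ->
    (forall y, y != point -> \sum_(u <- s | u.2 == y) u.1 = 0) ->
  lincomb f s = 0.
Proof.
move=> f0 s0; rewrite /lincomb.
rewrite (eq_big_seq (fun u : R * M =>
    \sum_(y <- undup [seq v.2 | v <- s] | u.2 == y) u.1 *: f y)); last first.
  move=> u us; rewrite (big_rem u.2)/=; last by rewrite mem_undup map_f.
  rewrite eqxx big_seq_cond big1 ?addr0// => y /andP[].
  rewrite mem_rem_uniq ?undup_uniq// inE => /andP[/negPf yu _].
  by rewrite eq_sym yu.
rewrite (exchange_big_dep xpredT)//= big1// => y _.
rewrite -scaler_suml; have [->|/s0 ->] := eqVneq y point; rewrite ?scale0r//.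
by rewrite f0 scaler0.
Qed.

Definition pairing (mu : molecules R M) (h : fct0 R M) : R :=
  (span_val mu : Defs.dual (fct0 R M)) h.

Lemma pairingD mu nu h : pairing (mu + nu) h = pairing mu h + pairing nu h.
Proof.
pose at_h (phi : Defs.dual (fct0 R M)) : R := phi h.
exact: etrans (congr1 at_h (span_valD mu nu)) (dual_funD _ _ h).
Qed.

Lemma pairingZ a mu h : pairing (a *: mu) h = a * pairing mu h.
Proof.
pose at_h (phi : Defs.dual (fct0 R M)) : R := phi h.
exact: etrans (congr1 at_h (span_valZ a mu)) (dual_funZ _ _ h).
Qed.

Lemma pairing0 h : pairing 0 h = 0.
Proof. by rewrite -(scale0r (0 : molecules R M)) pairingZ mul0r. Qed.

Lemma pairing_delta x h : pairing (delta R x) h = h x.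
Proof. by []. Qed.

Lemma pairing_lincomb s h :
  pairing (lincomb (@delta R M) s) h = \sum_(u <- s) u.1 * h u.2.
Proof.
elim: s => [|u s IHs]; first by rewrite /lincomb !big_nil pairing0.
by rewrite /lincomb !big_cons pairingD pairingZ pairing_delta IHs.
Qed.

Lemma vanish_centered (h : M -> R) :
  (fun x => h x - h point : R^o) \in @vanish_pred R M.
Proof. by rewrite /vanish_pred unfold_in subrr. Qed.

(** Subtracting the value at the base point turns any function on M into an
    element of the space on which molecules act. *)
Definition centered (h : M -> R) : fct0 R M := Fct0 (vanish_centered h).

(** A molecule determines the weight of every point y other than the base point,
    as its value on the indicator of y. *)
Lemma pairing_atom s y : y != point ->
  pairing (lincomb (@delta R M) s) (centered (fun x => (x == y)%:R)) =
  \sum_(u <- s | u.2 == y) u.1.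
Proof.
move=> y0; rewrite pairing_lincomb [RHS]big_mkcond; apply: eq_bigr => u _ /=.
rewrite [point == y]eq_sym (negPf y0) subr0.
by case: eqP; rewrite ?mulr1 ?mulr0.
Qed.

(** Two expressions of one molecule differ by a formal combination all of whose
    weights away from the base point vanish, so [lincomb f] takes the same value
    on both. *)
Lemma linear_extension (Y : lmodType R) (f : M -> Y) : f point = 0 ->
  exists2 L : molecules R M -> Y, linear L &
    forall s, L (lincomb (@delta R M) s) = lincomb f s.
Proof.
move=> f0.
have wd s t : lincomb (@delta R M) s = lincomb (@delta R M) t ->
    lincomb f s = lincomb f t.
  move=> st; apply/eqP; rewrite -subr_eq0 addrC -scaleN1r lincomb_scaleD.
  apply/eqP/lincomb_eq0 => // y y0; rewrite -pairing_atom// -lincomb_scaleD st.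
  by rewrite scaleN1r addNr pairing0.
have /choice[L LE] mu : exists y,
    forall s, mu = lincomb (@delta R M) s -> y = lincomb f s.
  by have [s ->] := molecule_lincomb mu; exists (lincomb f s) => t /wd.
exists L => [c mu nu|s]; last exact: LE.
have [s muE] := molecule_lincomb mu; have [t nuE] := molecule_lincomb nu.
rewrite (LE _ _ muE) (LE _ _ nuE) lincomb_scaleD; apply: LE.
by rewrite -lincomb_scaleD -muE -nuE.
Qed.

End Molecules.

(** * The ball seminorms *)

Section PSeminorms.
Variables (R : realType) (M : pointedType).
Variables (p : R) (rho : M -> M -> R).
Hypotheses (p01 : 0 < p <= 1) (rhoM : is_pmetric p rho).

Let p0 : 0 < p. Proof. by case/andP: p01. Qed.
Let pneq0 : p != 0. Proof. by rewrite gt_eqF. Qed.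

Definition ball_fct (c : M) (s : R) : fct0 R M :=
  centered (fun x => (rho c x `^ p < s)%R%:R).

(** This is the p-th power of the L_p norm of s |-> mu(1_B - 1_B(0)), with B the
    ball of center c and radius s for the metric d = rho ^ p. L_p replaces
    scalar Lipschitz functions, of which there may be too few when p < 1: if
    d is the distance of an interval, then rho = d ^ (1 / p) admits only
    constant ones. *)
Definition ball_int (c : M) (mu : molecules R M) : \bar R :=
  (\int[lebesgue_measure]_s (`|pairing mu (ball_fct c s)| `^ p)%:E)%E.

Lemma measurable_ball_int c (mu : molecules R M) :
  measurable_fun [set: R]
    (fun s : R => (`|pairing mu (ball_fct c s)| `^ p)%:E : \bar R).
Proof.
have [u ->] := molecule_lincomb mu.
apply/measurable_EFinP.
apply: (measurableT_comp (measurable_powR p)).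
apply: measurableT_comp => //.
rewrite (_ : (fun _ => _) =
    fun s => \sum_(v <- u) v.1 * ball_fct c s v.2); last first.
  by apply/funext => s; rewrite pairing_lincomb.
apply: measurable_sum => v; apply: measurable_funM => //.
have step t : measurable_fun [set: R] (fun s : R => (t < s)%R%:R : R).
  rewrite (_ : (fun _ => _) = \1_(`]t, +oo[%classic)).
    exact: measurable_indic.
  by apply/funext => s; rewrite indicE mem_setE in_itv/= andbT.
by apply: measurable_funB.
Qed.

Lemma ball_int_ge0 c mu : (0 <= ball_int c mu)%E.
Proof. by apply: integral_ge0 => s _; rewrite lee_fin powR_ge0. Qed.

Lemma ball_intZ c a mu :
  ball_int c (a *: mu) = ((`|a| `^ p)%:E * ball_int c mu)%E.
Proof.
rewrite -ge0_integralZl_EFin ?powR_ge0//; last exact: measurable_ball_int.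
by apply: eq_integral => s _; rewrite pairingZ normrM powRM.
Qed.

Lemma ball_int_subadditive c mu nu :
  (ball_int c (mu + nu)%R <= ball_int c mu + ball_int c nu)%E.
Proof.
rewrite -ge0_integralD//;
  [|exact: measurable_ball_int|exact: measurable_ball_int].
apply: ge0_le_integral => //.
- exact: measurable_ball_int.
- by apply: emeasurable_funD; exact: measurable_ball_int.
- by move=> s _; rewrite -EFinD lee_fin pairingD powR_normD.
Qed.

(** The function attached to a difference of two atoms is, up to sign, the
    indicator of the interval with end points d(c, x) and d(c, y), of length
    at most d(x, y) by the triangle inequality. *)
Lemma ball_int_delta c x y :
  (ball_int c (delta R x - delta R y)%R <= (rho x y `^ p)%:E)%E.
Proof.
set a := rho c x `^ p; set b := rho c y `^ p.
pose I := `]Num.min a b, Num.max a b]%classic.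
have -> : ball_int c (delta R x - delta R y) =
    (\int[lebesgue_measure]_s (\1_I s)%:E)%E.
  apply: eq_integral => s _; congr EFin.
  rewrite pairingD -scaleN1r pairingZ !pairing_delta mulN1r /=.
  rewrite opprB addrA subrK.
  rewrite indicE mem_setE in_itv/= -/a -/b.
  rewrite gt_min le_max !leNgt.
  by case: (a < s); case: (b < s);
    rewrite /= ?subrr ?subr0 ?sub0r ?normrN ?normr1 ?normr0 ?powR1 ?powR0.
rewrite integral_indic//; last exact: measurable_itv.
rewrite classical_sets.setIT /I /= lebesgue_measure_itv/= lte_fin.
have ab : a - b <= rho x y `^ p.
  by rewrite lerBlDr addrC (pmetric_sym rhoM x y) (pmetric_triangle rhoM).
have ba : b - a <= rho x y `^ p.
  by rewrite lerBlDr addrC (pmetric_triangle rhoM).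
case: ifP => _; last by rewrite lee_fin powR_ge0.
rewrite -EFinD lee_fin.
by case: (leP a b).
Qed.

Lemma delta_point : delta R (point : M) = 0.
Proof.
apply: val_inj; apply: val_inj; apply/funext => h /=.
by case: h => h h0; exact/eqP.
Qed.

Lemma ball_int_fin c mu : ball_int c mu \is a fin_num.
Proof.
rewrite ge0_fin_numE ?ball_int_ge0//.
have [s ->] := molecule_lincomb mu.
elim: s => [|u s IHs].
  rewrite /lincomb big_nil -(scale0r (0 : molecules R M)) ball_intZ.
  by rewrite normr0 powR0// mul0e ltry.
rewrite /lincomb big_cons; apply: le_lt_trans (ball_int_subadditive _ _ _) _.
apply: lte_add_pinfty; last exact: IHs.
rewrite ball_intZ.
rewrite -[delta R u.2]subr0 -delta_point.
apply: le_lt_trans (lee_wpmul2l _ (ball_int_delta c u.2 point)) _ => //.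
by rewrite -EFinM ltry.
Qed.

(** Finitely many positive distances have a positive lower bound. For y an atom of
    a molecule and s its support, small balls around y thus isolate it. *)
Lemma separated_center (y : M) (s : seq M) :
  exists2 r, 0 < r & forall x, x \in s -> x != y -> r <= rho y x `^ p.
Proof.
elim: s => [|x s [r r0 rs]]; first by exists 1.
have [->|xy] := eqVneq x y.
  by exists r => // z; rewrite inE => /orP[/eqP ->|/rs//]; rewrite eqxx.
exists (Num.min r (rho y x `^ p)).
  rewrite lt_min r0 powR_gt0// lt_neqAle (pmetric_ge0 rhoM) andbT eq_sym.
  by apply: contra xy => /eqP/(pmetric_eq0 rhoM) ->.
move=> z; rewrite inE ge_min => /orP[/eqP -> _|zs zy].
  by rewrite lexx orbT.
by rewrite rs.
Qed.

(** A nonzero molecule has a point y other than the base point with weight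
    m != 0. Every sufficiently small ball around y contains no other atom and
    not the base point, so its mass is m. *)
Lemma ball_int_gt0 mu : mu != 0 -> exists c, (0 < ball_int c mu)%E.
Proof.
have [s ->] := molecule_lincomb mu => mu0.
have [y y0 my] : exists2 y, y != point & \sum_(u <- s | u.2 == y) u.1 != 0.
  apply: contrapT => H; move/eqP: mu0; apply; apply: lincomb_eq0 => [|y y0].
    exact: delta_point.
  by apply: contrapT => /eqP my; apply: H; exists y.
set m := \sum_(u <- s | _) _ in my; exists y.
have [r r0 rs] := separated_center y (point :: [seq u.2 | u <- s]).
have pairE t : t \in `]0, r] ->
    pairing (lincomb (@delta R M) s) (ball_fct y t) = m.
  rewrite in_itv/= => /andP[t0 tr]; rewrite pairing_lincomb.
  rewrite /m [RHS]big_mkcond/=.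
  have near x : x \in point :: [seq u.2 | u <- s] ->
      (rho y x `^ p < t) = (x == y).
    move=> xs; have [->|xy] := eqVneq x y.
      by rewrite (pmetric_eq0 rhoM _ _).2// powR0.
    by apply/negbTE; rewrite -leNgt (le_trans tr) ?rs.
  apply: eq_big_seq => u us /=.
  rewrite !near ?mem_head//; last by rewrite inE map_f ?orbT.
  rewrite [point == y]eq_sym (negPf y0) subr0.
  by case: eqP; rewrite ?mulr1 ?mulr0.
have : (0 < \int[lebesgue_measure]_(t in `]0%R, r]%classic)
    (cst (`|m| `^ p)%:E t))%E.
  rewrite integral_cst//= lebesgue_measure_itv/= lte_fin r0 -EFinD -EFinM.
  by rewrite lte_fin subr0 mulr_gt0// powR_gt0// normr_gt0.
move=> /lt_le_trans; apply.
rewrite (_ : integral _ _ _ = (\int[lebesgue_measure]_(t in `]0%R, r]%classic)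
   (`|pairing (lincomb (@delta R M) s) (ball_fct y t)| `^ p)%:E)%E); last first.
  by apply: eq_integral => t; rewrite mem_setE => /pairE ->.
by apply: ge0_subset_integral => //; exact: measurable_ball_int.
Qed.

Definition ball_seminorm c mu : R := fine (ball_int c mu) `^ p^-1.

Lemma ball_seminorm_pseminorm c : is_pseminorm p (ball_seminorm c).
Proof.
have fine0 mu : 0 <= fine (ball_int c mu) by rewrite fine_ge0 ?ball_int_ge0.
split=> [mu|a mu|mu nu]; first exact: powR_ge0.
  rewrite /ball_seminorm ball_intZ fineM ?ball_int_fin//= powRM ?powR_ge0//.
  by rewrite powRK.
have trans x y z : 0 <= x -> 0 <= y -> 0 <= z -> x <= y + z ->
    (x `^ p^-1) `^ p <= (y `^ p^-1) `^ p + (z `^ p^-1) `^ p.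
  by move=> *; rewrite !powRVK.
apply: trans => //.
have := ball_int_subadditive c mu nu.
have := ball_int_fin c mu; have := ball_int_fin c nu.
have := ball_int_fin c (mu + nu).
move: (ball_int c mu) (ball_int c nu) (ball_int c (mu + nu)).
by move=> [x| |] [y| |] [z| |].
Qed.

Lemma ball_seminorm_delta c x y :
  ball_seminorm c (delta R x - delta R y) <= rho x y.
Proof.
rewrite -[leRHS](powRK pneq0) ?(pmetric_ge0 rhoM)//.
apply: ge0_ler_powR; rewrite ?nnegrE ?powR_ge0 ?invr_ge0 ?(ltW p0)
  ?fine_ge0 ?ball_int_ge0//.
by rewrite -lee_fin fineK ?ball_int_fin// ball_int_delta.
Qed.

Lemma ball_seminorm_gt0 mu : mu != 0 -> exists c, 0 < ball_seminorm c mu.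
Proof.
move=> /ball_int_gt0[c c0]; exists c; apply: powR_gt0.
by rewrite fine_gt0// c0 -ge0_fin_numE ?ball_int_ge0// ball_int_fin.
Qed.

(** * The free p-norm as a largest p-seminorm *)

Definition lipschitz_pseminorms : set (molecules R M -> R) :=
  [set q | is_pseminorm p q /\
    forall x y, q (delta R x - delta R y) <= rho x y]%classic.

(** Since delta(0) = 0, the Lipschitz condition bounds q(delta(x)) by rho(x, 0),
    and the p-triangle inequality adds these bounds up. *)
Lemma lipschitz_pseminorm_bounded mu :
  has_ubound [set q mu | q in lipschitz_pseminorms]%classic.
Proof.
have [s ->] := molecule_lincomb mu.
exists ((\sum_(u <- s) `|u.1| `^ p * rho u.2 point `^ p) `^ p^-1).
move=> _ [q [[q0 qZ qD] qL] <-]; rewrite -[leLHS](powRK pneq0)//.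
have sum0 (t : seq (R * M)) :
    0 <= \sum_(u <- t) `|u.1| `^ p * rho u.2 point `^ p.
  by apply: sumr_ge0 => u _; rewrite mulr_ge0// powR_ge0.
apply: ge0_ler_powR; rewrite ?nnegrE ?powR_ge0 ?invr_ge0 ?(ltW p0)//.
elim: s => [|u s IHs].
  rewrite /lincomb !big_nil -(scale0r (0 : molecules R M)) qZ.
  by rewrite normr0 mul0r powR0.
rewrite /lincomb !big_cons; apply: le_trans (qD _ _) _; apply: lerD => //.
rewrite qZ powRM// ler_wpM2l ?powR_ge0//.
apply: ge0_ler_powR; rewrite ?nnegrE ?(ltW p0) ?(pmetric_ge0 rhoM)//.
by rewrite -[delta R u.2]subr0 -delta_point.
Qed.

Definition largest_pseminorm (mu : molecules R M) : R :=
  sup [set q mu | q in lipschitz_pseminorms]%classic.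

Lemma largest_pseminorm_pnorm : is_pnorm p largest_pseminorm.
Proof.
have ballS c : lipschitz_pseminorms (ball_seminorm c).
  by split; [exact: ball_seminorm_pseminorm|exact: ball_seminorm_delta].
apply: pnorm_sup => //.
- by exists (ball_seminorm point).
- by move=> q [].
- exact: lipschitz_pseminorm_bounded.
- by move=> mu /ball_seminorm_gt0[c c0]; exists (ball_seminorm c).
Qed.

Lemma largest_pseminorm_delta x y :
  largest_pseminorm (delta R x - delta R y) <= rho x y.
Proof.
apply: ge_sup => [|_ [q [_ qL] <-]//].
exists (ball_seminorm point (delta R x - delta R y)).
exists (ball_seminorm point) => //.
by split; [exact: ball_seminorm_pseminorm|exact: ball_seminorm_delta].
Qed.

(** A test map f into Y extends linearly to molecules and pulls the p-norm of Y
    back to a Lipschitz p-seminorm, so the supremum is at most the largest one.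
    It is attained at f = delta, with molecules normed by the largest
    p-seminorm, because that one is a genuine p-norm. *)
Lemma Fp_supE N (a : 'I_N -> R) (x : 'I_N -> M) :
  Fp_sup p rho a x = (largest_pseminorm (\sum_(j < N) a j *: delta R (x j)))%:E.
Proof.
apply/eqP; rewrite eq_le; apply/andP; split.
  apply: ge_ereal_sup => _ [Y [nY [f [nYP fL f0 ->]]]].
  have [L Llin LE] := linear_extension f0.
  rewrite lee_fin !lincomb_ord -LE; set mu := lincomb _ _.
  apply: (ub_le_sup (lipschitz_pseminorm_bounded mu)); exists (nY \o L) => //.
  have L0 : L 0 = 0 by have := LE [::]; rewrite /lincomb !big_nil.
  have LD mu1 mu2 : L (mu1 + mu2) = L mu1 + L mu2.
    by have := Llin 1 mu1 mu2; rewrite !scale1r.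
  have LZ c mu1 : L (c *: mu1) = c *: L mu1.
    by have := Llin c mu1 0; rewrite L0 !addr0.
  have Ldelta z : L (delta R z) = f z.
    by have := LE [:: (1, z)]; rewrite /lincomb !big_seq1 !scale1r.
  split; first split=> [mu1|c mu1|mu1 mu2] /=.
  - exact: (pnorm_ge0 nYP).
  - by rewrite LZ (pnormZ nYP).
  - by rewrite LD (pnorm_triangle nYP).
  - by move=> y z /=; rewrite LD -scaleN1r LZ scaleN1r !Ldelta.
apply: ereal_sup_ubound; exists (molecules R M : lmodType R).
exists largest_pseminorm, (@delta R M).
split=> //.
- exact: largest_pseminorm_pnorm.
- exact: largest_pseminorm_delta.
- exact: delta_point.
Qed.

Lemma Fp_normE mu : Fp_norm p rho mu = (largest_pseminorm mu)%:E.
Proof.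
apply: xget_unique => [|r [N [a [x [-> ->]]]]]; last exact: Fp_supE.
have [s ->] := molecule_lincomb mu.
exists (size s), (fun j => (tnth (in_tuple s) j).1).
exists (fun j => (tnth (in_tuple s) j).2).
have E : lincomb (@delta R M) s =
    \sum_(j < size s)
      (tnth (in_tuple s) j).1 *: delta R (tnth (in_tuple s) j).2.
  by rewrite /lincomb [LHS](big_tnth _ _ s).
by rewrite Fp_supE E.
Qed.

End PSeminorms.

Theorem proposition4p1 (R : realType) (p : R) (M : pointedType)
    (rho : M -> M -> R) :
  0 < p <= 1 -> is_pmetric p rho ->
  [/\ forall (N : nat) (a : 'I_N -> R) (x : 'I_N -> M),
        Fp_norm p rho (\sum_(j < N) a j *: delta R (x j)) = Fp_sup p rho a x,
      forall mu : molecules R M, Fp_norm p rho mu \is a fin_num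
    & is_pnorm p (fun mu : molecules R M => fine (Fp_norm p rho mu))].
Proof.
move=> p01 rhoM; split=> [N a x|mu|].
- by rewrite Fp_normE// Fp_supE.
- by rewrite Fp_normE.
- rewrite (_ : (fun _ => _) = largest_pseminorm p rho).
    exact: largest_pseminorm_pnorm.
  by apply/funext => mu; rewrite Fp_normE.
Qed.
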